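(* Let $1 \le k < n$ be integers. The FFLV-polytope $\mathcal{C}(Q_{k,n})$ for $\mathrm{Gr}(k,n)$ is unimodular equivalent to the matching field polytope $P_{\mathcal{B}_{k,n}}$ of the FFLV matching field $\mathcal{B}_{k,n}$.
   Context: Write $[n]=\{1,\dots,n\}$ and $\binom{[n]}{k}$ for the set of $k$-subsets of $[n]$. Matching fields. A matching field for $\mathrm{Gr}(k,n)$ is a map $\Lambda: \binom{[n]}{k} \to S_k$. For $I = \{i_1 < \dots < i_k\}$ the tuple of $\Lambda$ associated to $I$ is $(i_{\sigma(1)}, \dots, i_{\sigma(k)})$ with $\sigma = \Lambda(I)$. With $e_{i,j}$ the standard basis of $\mathbb{R}^{k\times n}$, the matching field polytope is $P_\Lambda = \mathrm{Conv}\{ \sum_{i=1}^k e_{i,j_i} : (j_1,\dots,j_k) \text{ a tuple of } \Lambda\}$. A weight matrix $M=(m_{i,j}) \in \mathbb{R}^{k\times n}$ is generic if for each $J=\{j_1<\dots<j_k\}$ the minimum of $\sum_{i=1}^k m_{i,j_{\sigma(i)}}$ over $\sigma\in S_k$ is attained by a unique permutation $\sigma_J$; the matching field induced by $M$ is $J\mapsto\sigma_J$. FFLV matching field. Let $\mathrm{Diag}$ be the $k\times n$ matrix with entries $\mathrm{Diag}_{i,j} = (i-1)(n+1-j)$, let $N$ be a sufficiently large integer ($N=n^3$ is sufficient), and let $D=(d_{i,j})$ be the $k \times n$ matrix with $d_{i,j}=N$ if $i=j$ and $d_{i,j}=0$ otherwise. Set $M^{\mathrm{FFLV}} = \mathrm{Diag}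 - D$. The FFLV matching field $\mathcal{B}_{k,n}$ is the matching field induced by $M^{\mathrm{FFLV}}$. FFLV-polytope. Let $Q_{k,n} = \{(i,j)\in\mathbb{Z}^2 : 1\le i\le k,\ 1 \le j \le n-k\}$ be the poset with $(a,b) \le (c,d)$ iff $a \le c$ and $b \le d$. For a finite poset $\Pi=\{p_1,\dots,p_d\}$ the chain polytope is $\mathcal{C}(\Pi)=\{x\in\mathbb{R}^d : x_{i_1}+\dots+x_{i_s}\le 1 \text{ if } p_{i_1}<\dots<p_{i_s},\ x_i\ge 0 \text{ for all } i\}$. The FFLV-polytope for $\mathrm{Gr}(k,n)$ is defined to be $\mathcal{C}(Q_{k,n})$. Two lattice polytopes $P,Q$ are unimodular equivalent if there is an affine isomorphism between their affine spans that maps $P$ onto $Q$ and restricts to a bijection between their distinguished lattices, the distinguished lattice of a polytope being the $\mathbb{Z}$-affine span of its vertices. *)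

(* Defs.v *)
From HB Require Import structures.
From mathcomp Require Import all_boot all_order all_algebra all_fingroup zify ring lra.
From mathcomp Require Import boolp classical_sets functions reals.

Set Implicit Arguments.
Unset Strict Implicit.
Unset Printing Implicit Defensive.

Import Order.TTheory GRing.Theory Num.Theory.
Local Open Scope classical_set_scope.
Local Open Scope ring_scope.

(* Polytopes are sets of points of a real vector space. *)

Section Polytopes.
Variables (R : realType) (V : lmodType R).
Implicit Types P : set V.

Definition convex_hull P : set V :=
  [set x | exists m (c : 'I_m -> R) (p : 'I_m -> V),
    [/\ forall i, P (p i), forall i, 0 <= c i, \sum_i c i = 1 &
        x = \sum_i c i *: p i]].

Definition affine_span P : set V :=
  [set x | exists m (c : 'I_m -> R) (p : 'I_m -> V),
    [/\ forall i, P (p i), \sum_i c i = 1 & x = \sum_i c i *: p i]].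

Definition int_affine_span P : set V :=
  [set x | exists m (c : 'I_m -> int) (p : 'I_m -> V),
    [/\ forall i, P (p i), \sum_i c i = 1 & x = \sum_i p i *~ c i]].

Definition vertices P : set V :=
  [set x | P x /\ forall y z (t : R), P y -> P z -> 0 < t < 1 ->
    x = t *: y + (1 - t) *: z -> y = x /\ z = x].

Definition distinguished_lattice P : set V := int_affine_span (vertices P).

End Polytopes.

Definition affine_map_on (R : realType) (V W : lmodType R)
    (A : set V) (f : V -> W) : Prop :=
  forall (t : R) x y, A x -> A y ->
    f (t *: x + (1 - t) *: y) = t *: f x + (1 - t) *: f y.

Definition unimodular_equivalent (R : realType) (V W : lmodType R)
    (P : set V) (Q : set W) : Prop :=
  exists f : V -> W,
    [/\ affine_map_on (affine_span P) f,
        set_bij (affine_span P) (affine_span Q) f,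
        f @` P = Q &
        set_bij (distinguished_lattice P) (distinguished_lattice Q) f].

Definition chain_polytope (R : realType) (d : Order.disp_t)
    (Pi : finPOrderType d) : set {ffun Pi -> R^o} :=
  [set x : {ffun Pi -> R^o} | (forall p, (0 : R) <= x p) /\
    forall s : seq Pi, sorted <%O s -> \sum_(p <- s) x p <= (1 : R)].

Arguments chain_polytope R {d} Pi _.

(* `*p` carries the componentwise order. *)
Definition FFLV_polytope (R : realType) (k n : nat) :
    set {ffun 'I_k *p 'I_(n - k) -> R^o} :=
  chain_polytope R ('I_k *p 'I_(n - k))%type.

Arguments FFLV_polytope R k n _ : clear implicits.

Definition ksubset (k n : nat) := {J : {set 'I_n} | #|J| == k}.

(* The elements of J in increasing order. *)
Definition elt (k n : nat) (J : ksubset k n) (i : 'I_k) : 'I_n :=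
  Order.enum_val (cast_ord (esym (eqP (valP J))) i).

Definition matching_field (k n : nat) := ksubset k n -> 'S_k.

Definition matching_tuple (k n : nat) (L : matching_field k n)
    (J : ksubset k n) (i : 'I_k) : 'I_n :=
  elt J (L J i).

Definition matching_field_polytope (R : realType) (k n : nat)
    (L : matching_field k n) : set 'M[R]_(k, n) :=
  convex_hull (range (fun J : ksubset k n =>
    \sum_(i < k) delta_mx i (matching_tuple L J i))).

Arguments matching_field_polytope R {k n} L _.

Section Induced.
Variables (R : realType) (k n : nat) (M : 'M[R]_(k, n)).

Definition weight (J : ksubset k n) (s : 'S_k) : R :=
  \sum_(i < k) M i (elt J (s i)).

Definition unique_minimizer (J : ksubset k n) (s : 'S_k) : bool :=
  [forall t : 'S_k, (t != s) ==> (weight J s < weight J t)].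

Definition generic : Prop :=
  forall J : ksubset k n, exists s, unique_minimizer J s.

Definition induced_matching_field (gM : generic) : matching_field k n :=
  fun J => xchoose (gM J).

End Induced.

(* Rows and columns are numbered from 0, so that (i-1)(n+1-j) reads i * (n-j). *)
Definition Diag (R : realType) (k n : nat) : 'M[R]_(k, n) :=
  \matrix_(i < k, j < n) (i * (n - j))%:R.

Definition FFLV_weight (R : realType) (k n N : nat) : 'M[R]_(k, n) :=
  Diag R k n - \matrix_(i < k, j < n) (if i == j :> nat then N%:R else 0).

Fact Diag_bound n : (0 < n)%N -> ((n - 1) * n + (n - 1) * n < n ^ 3)%N.
Proof.
case: n => // m _; rewrite subn1 /= !expnS expn0 muln1 mulnA -mulnDl ltn_mul2r /=.
rewrite mulnS mulSn; case: m => // m.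
by have := leq_addr (m * m) m; rewrite !mulSn !mulnS; lia.
Qed.

Fact Diag_exchange n a b c d :
  (c < d)%N -> (a < n)%N -> (b < n)%N -> (b <= a)%N -> b <> a ->
  (c * (n - b) + d * (n - a) < c * (n - a) + d * (n - b))%N.
Proof.
move=> cd ha hb le_ba nab.
rewrite (_ : d = c + (d - c))%N; last lia.
rewrite (_ : n - b = n - a + (a - b))%N; last lia.
have : (0 < (d - c) * (a - b))%N by rewrite muln_gt0; lia.
by rewrite !mulnDl !mulnDr; lia.
Qed.

Section Genericity.
Variables (R : realType) (k n N : nat).
Hypothesis hN : (n ^ 3 <= N)%N.
Variable J : ksubset k n.
Let w := weight (FFLV_weight R k n N) J.
Let e := elt J.

Let e_inj : injective e.
Proof. by move=> i j /Order.EnumVal.enum_val_inj /cast_ord_inj. Qed.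

Let ee_inj i j : e i = e j :> nat -> i = j.
Proof. by move=> /ord_inj /e_inj. Qed.

Let swap_lt (s : 'S_k) (r q : 'I_k) : r != q ->
  let a : nat := e (s r) in let b : nat := e (s q) in
  (r * (n - b) + q * (n - a) + N * (r == a :> nat) + N * (q == b :> nat)
   < r * (n - a) + q * (n - b) + N * (r == b :> nat) + N * (q == a :> nat))%N ->
  w (tperm r q * s)%g < w s.
Proof.
move=> rq a b; rewrite -(ltr_nat R) !natrD => H.
rewrite /w /weight.
rewrite (bigD1 r) //= (bigD1 q) 1?eq_sym //= [ltRHS](bigD1 r) //=.
rewrite [X in _ < _ + X](bigD1 q) 1?eq_sym //= !permM tpermL tpermR.
rewrite (eq_bigr (fun i => FFLV_weight R k n N i (e (s i)))); last first.
  by move=> i /andP[ir iq]; rewrite permM tpermD // eq_sym.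
rewrite !addrA ltrD2r !mxE.
have E (i j : nat) : (if i == j then N%:R else 0) = (N * (i == j))%:R :> R.
  by case: eqP; rewrite ?muln1 ?muln0.
by rewrite !E -/e -/a -/b; lra.
Qed.

Let canonical (s : 'S_k) :=
  (forall r i : 'I_k, e i = r :> nat -> s r = i) /\
  (forall r q : 'I_k, (r < q)%N -> e (s r) <> r :> nat ->
     e (s q) <> q :> nat -> (e (s r) < e (s q))%N).

Let min_canonical (s : 'S_k) : (forall t, w s <= w t) -> canonical s.
Proof.
move=> smin; split=> [r i er | r q rq Er Eq].
- apply/eqP/negP=> /negP sri.
  have rq : r != (s^-1)%g i.
    by apply/eqP=> E; move: sri; rewrite E permKV eqxx.
  have := smin (tperm r ((s^-1)%g i) * s)%g.
  rewrite leNgt => /negP; apply; apply: swap_lt => //.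
  rewrite permKV er eqxx.
  have nra : (r == e (s r) :> nat) = false.
    by apply/eqP=> E; case/eqP: sri; apply: ee_inj; rewrite er.
  have nqr : ((s^-1)%g i == r :> nat) = false.
    by apply/eqP=> /ord_inj E; rewrite E eqxx in rq.
  rewrite nra nqr.
  have /= ha := ltn_ord (e (s r)); have /= hr := ltn_ord (e i).
  rewrite er in hr.
  set b := (s^-1)%g i; have hb := ltn_ord b.
  have hk : (k <= n)%N.
    by rewrite -(eqP (valP J)) -[leqRHS]card_ord max_card.
  have hbn : (b < n)%N by apply: leq_trans hk.
  have h1 : (r * (n - r) <= (n - 1) * n)%N by apply: leq_mul; lia.
  have h2 : (b * (n - e (s r)) <= (n - 1) * n)%N by apply: leq_mul; lia.
  have h3 := Diag_bound (leq_ltn_trans (leq0n _) hr).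
  rewrite !muln0 !addn0 muln1.
  apply: leq_ltn_trans (leq_add h1 h2) (leq_trans h3 (leq_trans hN _)).
  by rewrite -addnA addnCA leq_addr.
- rewrite ltnNge; apply/negP=> le_qr.
  have neq : r != q by apply/eqP=> E; rewrite E ltnn in rq.
  have nab : e (s q) <> e (s r) :> nat.
    by move=> /ee_inj /perm_inj E; rewrite E eqxx in neq.
  have := smin (tperm r q * s)%g.
  rewrite leNgt => /negP; apply; apply: swap_lt => //.
  move/eqP: Er; rewrite eq_sym => /negbTE ->.
  move/eqP: Eq; rewrite eq_sym => /negbTE ->.
  rewrite !muln0 !addn0 -addnA; apply: leq_trans (leq_addr _ _).
  by apply: Diag_exchange => //; exact: ltn_ord.
Qed.

Let canonical_uniq (s t : 'S_k) : canonical s -> canonical t -> s = t.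
Proof.
have step (s1 t1 : 'S_k) (r : 'I_k) : canonical s1 -> canonical t1 ->
    (forall q : 'I_k, (q < r)%N -> s1 q = t1 q) ->
    ~ (e (s1 r) < e (t1 r))%N.
  move=> [sA sB] [tA tB] IH lt_st.
  have nst : s1 r <> t1 r by move=> E; rewrite E ltnn in lt_st.
  set q := (t1^-1)%g (s1 r).
  have tq : t1 q = s1 r by rewrite permKV.
  have lt_rq : (r < q)%N.
    rewrite ltnNge leq_eqVlt; apply/negP=> /orP[/eqP /ord_inj E | lt_qr].
      by apply: nst; rewrite -tq E.
    by have := IH _ lt_qr; rewrite tq => /perm_inj E; rewrite E ltnn in lt_qr.
  have Er : e (t1 r) <> r :> nat by move=> E; apply: nst; apply: sA.
  have Eq : e (t1 q) <> q :> nat.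
    by rewrite tq => E; have /perm_inj E' := sA _ _ E; rewrite E' ltnn in lt_rq.
  by have := tB _ _ lt_rq Er Eq; rewrite tq ltnNge ltnW.
move=> cs ct; apply/permP => r.
have [m] := ubnP (nat_of_ord r); elim: m r => // m IHm r lt_rm.
have IH (q : 'I_k) : (q < r)%N -> s q = t q.
  by move=> qr; apply: IHm; apply: leq_trans qr _.
apply: ee_inj; case: (ltngtP (e (s r)) (e (t r))) => // H.
  by case: (step _ _ r cs ct IH H).
by case: (step _ _ r ct cs _ H) => q qr; rewrite IH.
Qed.

Lemma FFLV_weight_unique_minimizer :
  exists s, unique_minimizer (FFLV_weight R k n N) J s.
Proof.
pose s := [arg min_(t < (1%g : 'S_k)) w t]%O.
have smin t : w s <= w t by rewrite /s; case: arg_minP => // i _; exact.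
exists s; apply/forallP=> t; apply/implyP=> ts; rewrite lt_neqAle smin andbT.
apply: contra ts => /eqP E; apply/eqP.
by apply: canonical_uniq; apply: min_canonical => // u; rewrite /w -E; apply: smin.
Qed.

End Genericity.

Lemma FFLV_weight_generic (R : realType) (k n N : nat) :
  (n ^ 3 <= N)%N -> generic (FFLV_weight R k n N).
Proof. by move=> hN J; apply: FFLV_weight_unique_minimizer. Qed.

Definition FFLV_matching_field (R : realType) (k n N : nat)
    (hN : (n ^ 3 <= N)%N) : matching_field k n :=
  induced_matching_field (@FFLV_weight_generic R k n N hN).

Arguments FFLV_matching_field R k {n N} hN _.

(* Main.v *)
Require Import Defs.
From HB Require Import structures.
From mathcomp Require Import all_boot all_order all_algebra all_fingroup zify lra.
From mathcomp Require Import boolp classical_sets functions reals.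

Set Implicit Arguments.
Unset Strict Implicit.
Unset Printing Implicit Defensive.

Import Order.TTheory GRing.Theory Num.Theory.
Local Open Scope classical_set_scope.
Local Open Scope ring_scope.

(** The matching field polytope is an affine copy of the FFLV polytope.

    Number rows and columns from 0. Because of the weight [N] on the diagonal, the
    tuple attached to a [k]-subset [J] puts each element [c < k] of [J] in row [c].
    The remaining elements, all [>= k], occupy the rows that are left, and the term
    [Diag] forces them to increase with the row ([matching_fflv_tuple]). Hence the
    cells [(r, c)] of the tuple with [c >= k] form a set that increases strictly in
    both coordinates; after reversal of the rows it is an antichain of the
    rectangle of [k] rows and [n - k] columns. Every antichain occurs: put [r] in
    each row [r] that it misses. The subset is then the set of entries, and it
    determines the tuple, since the entries outside their own row are sorted
    ([fflv_tuple_uniq]).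

    The entries in columns [< k] vanish outside the diagonal, and the diagonal
    entry of a row is one minus the sum of its entries in the columns [>= k]. So
    the point of the tuple is the image of the indicator of the antichain under the
    injective affine map
      [x |-> \sum_r (e_(r,r) + \sum_j x_(k-1-r,j) (e_(r,k+j) - e_(r,r)))]
    ([embedding_generators]). The chain polytope is the convex hull of the
    indicators of antichains ([chain_polytope_convex_hull]), so this map sends it
    onto the matching field polytope, and an injective affine map is a unimodular
    equivalence onto its image ([unimodular_equivalent_image]), because the lattices
    are spanned by the vertices. *)

(** * Affine embeddings *)

Section AffineEmbedding.
Variables (R : realType) (V W : lmodType R) (b : W) (g : {linear V -> W}).
Let f x := b + g x.

Lemma translate_combo m (c : 'I_m -> R) (p : 'I_m -> V) :
  \sum_i c i = 1 -> f (\sum_i c i *: p i) = \sum_i c i *: f (p i).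
Proof.
move=> c1; rewrite /f (eq_bigr _ (fun i _ => scalerDr _ _ _)) big_split /=.
rewrite -scaler_suml c1 scale1r linear_sum.
by congr (_ + _); apply: eq_bigr => i _; rewrite linearZ.
Qed.

Lemma translate_int_combo m (c : 'I_m -> int) (p : 'I_m -> V) :
  \sum_i c i = 1 -> f (\sum_i p i *~ c i) = \sum_i f (p i) *~ c i.
Proof.
move=> c1; rewrite /f (eq_bigr _ (fun i _ => mulrzDl _ _ _)) big_split /=.
rewrite -mulrz_sumr c1 mulr1z linear_sum.
by congr (_ + _); apply: eq_bigr => i _; rewrite raddfMz.
Qed.

Lemma translate_line (t : R) x y :
  f (t *: x + (1 - t) *: y) = t *: f x + (1 - t) *: f y.
Proof.
rewrite /f linearD !linearZ /= !scalerDr addrACA -scalerDl.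
by rewrite addrC subrKC scale1r addrC.
Qed.

Lemma lift_family (P : set V) m (p : 'I_m -> W) :
  (forall i, (f @` P) (p i)) ->
  exists q : 'I_m -> V, (forall i, P (q i)) /\ (forall i, p i = f (q i)).
Proof.
move=> Pp; have [i|q qP] := @choice _ _ (fun i x => P x /\ p i = f x) _.
  by have [x Px <-] := Pp i; exists x.
by exists q; split=> i; have [] := qP i.
Qed.

Lemma image_convex_hull (P : set V) :
  f @` convex_hull P = convex_hull (f @` P).
Proof.
apply/seteqP; split=> [_ [_ [m [c [p [Pp c0 c1 ->]]]] <-] |
                       _ [m [c [p [Pp c0 c1 ->]]]]].
  exists m, c, (f \o p); split=> // [i|]; first by exists (p i).
  exact: translate_combo.
have [q [Pq pq]] := lift_family Pp.
exists (\sum_i c i *: q i); first by exists m, c, q.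
by rewrite translate_combo //; apply: eq_bigr => i _; rewrite pq.
Qed.

Lemma image_affine_span (P : set V) :
  f @` affine_span P = affine_span (f @` P).
Proof.
apply/seteqP; split=> [_ [_ [m [c [p [Pp c1 ->]]]] <-] |
                       _ [m [c [p [Pp c1 ->]]]]].
  exists m, c, (f \o p); split=> // [i|]; first by exists (p i).
  exact: translate_combo.
have [q [Pq pq]] := lift_family Pp.
exists (\sum_i c i *: q i); first by exists m, c, q.
by rewrite translate_combo //; apply: eq_bigr => i _; rewrite pq.
Qed.

Lemma image_int_affine_span (P : set V) :
  f @` int_affine_span P = int_affine_span (f @` P).
Proof.
apply/seteqP; split=> [_ [_ [m [c [p [Pp c1 ->]]]] <-] |
                       _ [m [c [p [Pp c1 ->]]]]].
  exists m, c, (f \o p); split=> // [i|]; first by exists (p i).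
  exact: translate_int_combo.
have [q [Pq pq]] := lift_family Pp.
exists (\sum_i q i *~ c i); first by exists m, c, q.
by rewrite translate_int_combo //; apply: eq_bigr => i _; rewrite pq.
Qed.

Hypothesis g_inj : injective g.

Let f_inj : injective f.
Proof. by move=> x y /addrI /g_inj. Qed.

Lemma image_vertices (P : set V) : f @` vertices P = vertices (f @` P).
Proof.
apply/seteqP; split=> [_ [x [Px vx] <-] | _ [[x Px <-] vx]].
  split=> [|_ _ t [y Py <-] [z Pz <-] t01]; first by exists x.
  by rewrite -translate_line => /f_inj /vx[] // -> ->.
exists x => //; split=> // y z t Py Pz t01 xyz.
have [||//||/f_inj-> /f_inj->//] := vx (f y) (f z) t.
- by exists y.
- by exists z.
- by rewrite -translate_line -xyz.
Qed.

Lemma image_bij (A : set V) : set_bij A (f @` A) f.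
Proof. by split=> [x Ax|x y _ _ /f_inj|//]; first by exists x. Qed.

(** Affine spans, vertices and lattices are all defined through affine
    combinations, so an injective affine map defined on the whole space
    transports each of them. *)
Lemma unimodular_equivalent_image (P : set V) :
  unimodular_equivalent P (f @` P).
Proof.
exists f; split=> //.
- by move=> t x y _ _; apply: translate_line.
- by rewrite -image_affine_span; apply: image_bij.
- rewrite /distinguished_lattice -image_vertices -image_int_affine_span.
  exact: image_bij.
Qed.

End AffineEmbedding.

(** * Chain polytopes *)

Section ChainPolytope.
Variables (R : realType) (d : Order.disp_t) (Pi : finPOrderType d).
Implicit Types (A : {set Pi}) (s : seq Pi) (x : Pi -> R).

Definition antichain A : bool :=
  [forall p in A, forall q in A, (p <= q)%O ==> (p == q)].

Lemma antichainP A :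
  reflect {in A &, forall p q, (p <= q)%O -> p = q} (antichain A).
Proof.
apply: (iffP forall_inP) => [aA p q Ap Aq pq | aA p Ap].
  by apply/eqP/(implyP (forall_inP (aA p Ap) q Aq)).
by apply/forall_inP => q Aq; apply/implyP => pq; apply/eqP/aA.
Qed.

Definition indicator A : {ffun Pi -> R^o} := [ffun p => (p \in A)%:R].

Definition antichain_indicators : set {ffun Pi -> R^o} :=
  [set indicator A | A in [set A | antichain A]].

(** The induction peels off the antichain [A] of minimal elements of the support
    of [x], with the largest multiple [e] that keeps [x] nonnegative: the support
    shrinks, and every chain sum is then at most [c - e]. For the latter, a chain
    within the support has its least element above some element of [A], so that
    it can be extended downwards to meet [A]. *)
Lemma antichain_decomposition x (c : R) :
  (forall p, 0 <= x p) ->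
  (forall s, sorted <%O s -> \sum_(p <- s) x p <= c) ->
  exists w : {set Pi} -> R,
    [/\ forall A, 0 <= w A, \sum_(A | antichain A) w A = c &
        forall p, x p = \sum_(A | antichain A) w A * (p \in A)%:R].
Proof.
pose supp y := [set p : Pi | 0 < y p :> R]%SET.
have [m] := ubnP #|supp x|; elim: m x c => // m IHm x c lt_m x0 xc.
pose A0 := [set p in supp x |
  [forall q in supp x, (q <= p)%O ==> (q == p)]]%SET.
have A0_supp p : p \in A0 -> 0 < x p by rewrite !inE => /andP[xp _].
have A0_min p q : p \in A0 -> 0 < x q -> (q <= p)%O -> q = p.
  rewrite inE => /andP[_ /forall_inP H] xq qp.
  by apply/eqP/(implyP (H q _)); rewrite ?inE.
have A0_anti : antichain A0.
  by apply/antichainP=> p q Ap Aq pq; apply: A0_min pq => //; apply: A0_supp.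
have below p : 0 < x p -> exists2 q, q \in A0 & (q <= p)%O.
  move=> xp; pose D q := (0 < x q) && (q <= p)%O.
  have Dp : D p by rewrite /D xp lexx.
  (* Among the elements of the support below [p], one with the fewest elements
     below it is minimal. *)
  case: (arg_minnP (fun q => #|[set z | (z <= q)%O]%SET|) Dp).
  move=> q /andP[xq qp] qmin.
  exists q => //; rewrite !inE xq; apply/forall_inP => z; rewrite inE => xz.
  apply/implyP => zq; apply/negP => /negP nzq.
  have := qmin z; rewrite /D xz (le_trans zq qp) => /(_ isT).
  rewrite leqNgt => /negP; apply; apply: proper_card.
  apply/properP; split.
    by apply/fintype.subsetP => u; rewrite !inE => /le_trans; apply.
  exists q; rewrite !inE ?lexx //.
  by apply: contra nzq => qz; rewrite eq_le zq qz.
have x_supp p : p \notin supp x -> x p = 0.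
  by rewrite inE lt_neqAle x0 andbT negbK => /eqP <-.
have [/eqP|] := posnP #|supp x|.
  rewrite cards_eq0 => /eqP s0.
  have c0 : 0 <= c by have := xc [::] isT; rewrite big_nil.
  have a0 : antichain finset.set0 by apply/antichainP => p q; rewrite inE.
  (* The empty antichain carries whatever weight the support leaves over. *)
  exists (fun A => if A == finset.set0 then c else 0); split=> [A||p].
  - by case: ifP.
  - rewrite (bigD1 finset.set0) //= eqxx big1 ?addr0 // => A /andP[_ /negbTE->].
    by [].
  - rewrite x_supp ?s0 ?inE // big1 // => A _.
    by case: eqP => [->|]; rewrite ?inE ?mulr0 ?mul0r.
rewrite card_gt0 => /set0Pn[p0]; rewrite inE => /below[p1 A0p1 _].
case: (arg_minP x A0p1) => pm A0pm_ pm_min.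
have A0pm : pm \in A0 by [].
set e := x pm in pm_min; have e0 : 0 < e by apply: A0_supp.
pose x' p := x p - e * (p \in A0)%:R.
have x'_le p : x' p <= x p by rewrite /x' gerBl mulr_ge0 ?ler0n // ltW.
have x'0 p : 0 <= x' p.
  rewrite /x'; case: (boolP (p \in A0)) => [Ap|_]; rewrite ?mulr0 ?subr0 //.
  by rewrite mulr1 subr_ge0; apply: pm_min.
have lt_supp : (#|supp x'| < m)%N.
  apply: leq_trans (_ : #|supp x| <= m)%N; last by rewrite -ltnS.
  apply: proper_card; apply/properP; split.
    by apply/fintype.subsetP => p; rewrite !inE => /lt_le_trans; apply.
  by exists pm; rewrite inE ?A0_supp // /x' A0pm mulr1 subrr ltxx.
have x'c s : sorted <%O s -> \sum_(p <- s) x' p <= c - e.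
  move=> sP; rewrite -(big_rmcond (mem (supp x))) /=; last first.
    move=> p /x_supp xp; apply/eqP; rewrite eq_le x'0 andbT.
    by rewrite -xp; apply: x'_le.
  rewrite -big_filter; have := sorted_filter lt_trans (mem (supp x)) sP.
  case def_s: (filter _ s) => [|p t] pt; rewrite ?big_nil ?big_cons.
    by have := xc [:: pm] isT; rewrite big_seq1 subr_ge0.
  have : p \in filter (mem (supp x)) s by rewrite def_s mem_head.
  rewrite mem_filter /= inE => /andP[/below[q A0q le_qp] _].
  have le_t : \sum_(j <- t) x' j <= \sum_(j <- t) x j by apply: ler_sum.
  have [eq_qp|neq_qp] := eqVneq q p.
    have := xc _ pt; rewrite big_cons; have : x' p = x p - e.
      by rewrite /x' -eq_qp A0q mulr1.
    lra.
  have /xc : sorted <%O [:: q, p & t] by rewrite /= lt_neqAle neq_qp le_qp.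
  rewrite !big_cons; have := x'_le p; have := pm_min q A0q; rewrite -/e; lra.
have [w [w0 wc wx]] := IHm x' _ lt_supp x'0 x'c.
exists (fun A => w A + (if A == A0 then e else 0)); split=> [A||p].
- by rewrite addr_ge0 //; case: ifP => // _; apply: ltW.
- rewrite big_split /= wc (bigD1 A0) //= eqxx big1 ?addr0 ?subrK //.
  by move=> A /andP[_ /negbTE->].
- rewrite (eq_bigr _ (fun A _ => mulrDl _ _ _)) big_split /= -wx.
  rewrite (bigD1 A0) //= eqxx big1 ?addr0 ?subrK //.
  by move=> A /andP[_ /negbTE->]; rewrite mul0r.
Qed.

(** A chain meets an antichain at most once. *)
Lemma indicator_chain_sum A s :
  antichain A -> sorted <%O s -> \sum_(p <- s) (p \in A)%:R <= 1 :> R.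
Proof.
move=> /antichainP aA /(sorted_filter lt_trans (mem A)) sP.
rewrite -natr_sum -big_mkcond /= -big_filter sum1_size lern1.
case def_s: (filter _ s) sP => [|p [|q t]] //= /andP[pq _].
have inA z : z \in [:: p, q & t] -> z \in A.
  by rewrite -def_s mem_filter => /andP[].
have := aA p q; rewrite !inA ?inE ?eqxx ?orbT // ltW // => /(_ isT isT isT) E.
by rewrite E ltxx in pq.
Qed.

(** A theorem of Stanley. Both inclusions come from the pairing of chains with
    antichains: an antichain contributes at most its weight to a chain sum, and
    conversely the chain bounds are what it takes to peel off antichains. *)
Lemma chain_polytope_convex_hull :
  chain_polytope R Pi = convex_hull antichain_indicators.
Proof.
apply/seteqP; split=> [x [x0 xc] | _ [m [c [p [Pp c0 c1 ->]]]]].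
  have [w [w0 w1 wx]] := antichain_decomposition x0 xc.
  exists #|[pred A | antichain A]|, (fun i => w (enum_val i)),
    (fun i => indicator (enum_val i)).
  split=> //.
  - by move=> i; exists (enum_val i) => //; exact: (enum_valP i).
  - by rewrite -(big_enum_val (A := [pred A | antichain A])).
  - rewrite -(big_enum_val (A := [pred A | antichain A])
      (fun A => w A *: indicator A)).
    apply/ffunP => q; rewrite wx sum_ffunE.
    by apply: eq_bigr => A _; rewrite !ffunE.
have [q qP] := @choice _ _ (fun i A => antichain A /\ indicator A = p i)
   (fun i => let: ex_intro2 A aA E := Pp i in ex_intro _ A (conj aA E)).
have pE i z : p i z = (z \in q i)%:R by rewrite -(qP i).2 ffunE.
split=> [z | s sP].
  by rewrite sum_ffunE sumr_ge0 // => i _; rewrite !ffunE pE mulr_ge0.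
under eq_bigr do rewrite sum_ffunE.
rewrite exchange_big /= -c1; apply: ler_sum => i _.
under eq_bigr do rewrite ffunE pE.
rewrite -mulr_sumr ler_piMr //; apply: indicator_chain_sum => //.
exact: (qP i).1.
Qed.

End ChainPolytope.

Arguments antichain_indicators R {d} Pi _.
(** * Tuples of the FFLV matching field *)

Section Tuples.
Variables (R : realType) (k n : nat).
Implicit Types (t : 'I_k -> 'I_n) (r q : 'I_k).

(** A description, free of weights, of the functions that arise as tuples of the
    FFLV matching field for some [k]-subset. *)
Definition fflv_tuple t : Prop :=
  [/\ injective t,
      forall r, t r <> r :> nat -> (k <= t r)%N &
      forall r q, (r < q)%N -> t r <> r :> nat -> t q <> q :> nat ->
        (t r < t q)%N].

Lemma fflv_tuple_fixed t r :
  fflv_tuple t -> (t r == r :> nat) = [exists q, t q == r :> nat].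
Proof.
move=> [_ big _]; apply/eqP/existsP => [E | [q /eqP E]].
  by exists r; apply/eqP.
have [F|Eq] := eqVneq (t q : nat) q.
  by have <- : q = r by apply: ord_inj; rewrite -F E.
by have := big q (elimN eqP Eq); rewrite E leqNgt ltn_ord.
Qed.

Lemma mem_moved t c : fflv_tuple t ->
  (c \in [seq t r | r <- enum 'I_k & t r != r :> nat]) =
  (c \in codom t) && (k <= c)%N.
Proof.
move=> [_ big _]; apply/mapP/andP => [[r] | [/codomP[r ->] kr]].
  rewrite mem_filter => /andP[/eqP tr _] ->.
  by rewrite codom_f; split=> //; apply: big.
exists r => //; rewrite mem_filter mem_enum andbT.
by apply/eqP => E; rewrite E leqNgt ltn_ord in kr.
Qed.

Lemma moved_sorted t : fflv_tuple t ->
  sorted <%O [seq t r | r <- enum 'I_k & t r != r :> nat].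
Proof.
move=> [_ _ incr].
apply: (homo_sorted_in (P := [pred r | t r != r :> nat]) (e := relpre val ltn)).
- by move=> r q /eqP tr /eqP tq /= rq; rewrite ltEord; apply: incr.
- exact: filter_all.
- apply: sorted_filter; first by move=> x y z /=; apply: ltn_trans.
  by rewrite -sorted_map val_enum_ord iota_ltn_sorted.
Qed.

(** The entries outside their own row form a strictly increasing sequence, which
    is determined by the set of its terms. *)
Lemma fflv_tuple_uniq t u :
  fflv_tuple t -> fflv_tuple u -> codom t =i codom u -> t =1 u.
Proof.
move=> ft fu tu.
have same r : (t r == r :> nat) = (u r == r :> nat).
  have E (v : 'I_k -> 'I_n) : [exists q, v q == r :> nat] =
      has (fun c : 'I_n => c == r :> nat) (codom v).
    apply/existsP/hasP => [[q vq] | [_ /codomP[q ->] vq]]; last by exists q.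
    by exists (v q) => //; apply: codom_f.
  by rewrite !fflv_tuple_fixed // !E; apply: eq_has_r.
have : [seq t r | r <- enum 'I_k & t r != r :> nat] =
       [seq u r | r <- enum 'I_k & t r != r :> nat].
  have eqf : [seq r <- enum 'I_k | t r != r :> nat] =
             [seq r <- enum 'I_k | u r != r :> nat].
    by apply: eq_filter => r; rewrite same.
  rewrite [in RHS]eqf; apply: lt_sorted_eq; try exact: moved_sorted.
  by move=> c; rewrite !mem_moved // tu.
move=> /eq_in_map moved r.
have [tr|tr] := eqVneq (t r : nat) r; last first.
  by apply: moved; rewrite mem_filter tr mem_enum.
by apply: ord_inj; rewrite tr; apply/esym/eqP; rewrite -same; apply/eqP.
Qed.

Lemma elt_inj (J : ksubset k n) : injective (elt J).
Proof. by move=> i j /Order.enum_val_inj /cast_ord_inj. Qed.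

Lemma matching_tuple_inj (L : matching_field k n) J :
  injective (matching_tuple L J).
Proof. by move=> r q /elt_inj /perm_inj. Qed.

Lemma codom_matching_tuple (L : matching_field k n) J :
  codom (matching_tuple L J) =i val J.
Proof.
apply/subset_cardP.
  by rewrite card_codom ?card_ord ?(eqP (valP J)) //; apply: matching_tuple_inj.
by apply/fintype.subsetP => _ /codomP[r ->]; apply: Order.enum_valP.
Qed.

(** Composing the minimizing permutation with a transposition cannot lower the
    weight. *)
Lemma minimizer_exchange (M : 'M[R]_(k, n)) J (s : 'S_k) r q :
  unique_minimizer M J s -> r != q ->
  M r (elt J (s r)) + M q (elt J (s q)) <= M r (elt J (s q)) + M q (elt J (s r)).
Proof.
move=> /forallP/(_ (tperm r q * s)%g)/implyP min_s rq.
have /min_s /ltW : (tperm r q * s)%g != s.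
  apply: contra rq => /eqP/permP/(_ r); rewrite permM tpermL.
  by move/perm_inj ->.
rewrite /weight (bigD1 r) //= (bigD1 q) 1?eq_sym //=.
rewrite [leRHS](bigD1 r) //= [X in _ <= _ + X](bigD1 q) 1?eq_sym //=.
rewrite !permM tpermL tpermR.
rewrite [X in _ <= _ + (_ + X) -> _](eq_bigr (fun i => M i (elt J (s i)))).
  by rewrite !addrA lerD2r.
by move=> i /andP[ir iq]; rewrite permM tpermD // eq_sym.
Qed.

Variables (N : nat) (hN : (n ^ 3 <= N)%N).

Lemma fflv_exchange J r q :
  let t := matching_tuple (FFLV_matching_field R k hN) J in r != q ->
  (r * (n - t r) + q * (n - t q) + N * (r == t q :> nat) + N * (q == t r :> nat)
   <= r * (n - t q) + q * (n - t r) + N * (r == t r :> nat)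
      + N * (q == t q :> nat))%N.
Proof.
move=> t rq.
have := minimizer_exchange (xchooseP (FFLV_weight_generic R hN J)) rq.
rewrite -/(FFLV_matching_field R k hN J) -/(matching_tuple _ J r).
rewrite -/(matching_tuple _ J q) -/t !mxE.
have E (i j : nat) : (if i == j then N%:R else 0) = (N * (i == j))%:R :> R.
  by case: eqP; rewrite ?muln1 ?muln0.
by rewrite !E -(ler_nat R) !natrD; lra.
Qed.

(** The large weight [N] on the diagonal puts the entries [c < k] in row [c]; the
    rearrangement inequality for [Diag] then sorts the others. *)
Lemma matching_fflv_tuple J :
  fflv_tuple (matching_tuple (FFLV_matching_field R k hN) J).
Proof.
set t := matching_tuple _ J.
have t_inj : injective t by apply: matching_tuple_inj.
split=> // [r tr | r q rq tr tq].
  rewrite leqNgt; apply/negP => ltk.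
  (* Row [q] is the one where the entry [t r < k] should stand. Moving it there
     gains [N], which outweighs any change of the two [Diag] terms. *)
  pose q : 'I_k := Ordinal ltk.
  have rq : r != q by apply/eqP => E; apply: tr; rewrite {2}E.
  have := fflv_exchange J rq; rewrite -/t.
  have tq : (q == t q :> nat) = false.
    apply/eqP => E; have /t_inj Erq : t r = t q by apply: ord_inj.
    by rewrite -Erq eqxx in rq.
  have rr : (r == t r :> nat) = false by apply/eqP => E; apply: tr.
  rewrite tq rr eqxx !muln0 !addn0 muln1 => /(leq_trans (leq_addl _ _)) leN.
  have h1 : (r * (n - t q) <= (n - 1) * n)%N.
    have := ltn_ord r; have := ltn_ord (t r); have := ltn_ord (t q).
    have hk : (k <= n)%N.
      by rewrite -(eqP (valP J)) -[leqRHS]card_ord max_card.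
    by move=> *; apply: leq_mul; lia.
  have h2 : (q * (n - t r) <= (n - 1) * n)%N.
    by have /= := ltn_ord (t r); move=> *; apply: leq_mul => /=; lia.
  have h3 := Diag_bound (leq_ltn_trans (leq0n _) (ltn_ord (t r))).
  have := leq_trans (leq_ltn_trans (leq_trans leN (leq_add h1 h2)) h3) hN.
  by rewrite ltnn.
have neq : r != q by apply/eqP => E; rewrite E ltnn in rq.
have := fflv_exchange J neq; rewrite -/t.
have -> : (r == t r :> nat) = false by apply/eqP => E; apply: tr.
have -> : (q == t q :> nat) = false by apply/eqP => E; apply: tq.
rewrite !muln0 !addn0 => le_exch; rewrite ltnNge; apply/negP => le_qr.
have nqr : t q <> t r :> nat by move=> /ord_inj/t_inj E; rewrite E ltnn in rq.
by have := Diag_exchange rq (ltn_ord (t r)) (ltn_ord (t q)) le_qr nqr; lia.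
Qed.

End Tuples.

(** * The embedding of the FFLV polytope *)

Section Embedding.
Variables (R : realType) (k n : nat) (hkn : (k <= n)%N).
Let Q : finPOrderType _ := ('I_k *p 'I_(n - k))%type.
Implicit Types (r : 'I_k) (j : 'I_(n - k)) (A : {set Q}) (t : 'I_k -> 'I_n).

Let diag r : 'I_n := widen_ord hkn r.
Let shift j : 'I_n := cast_ord (subnKC hkn) (rshift k j).

Definition base_matrix : 'M[R]_(k, n) := \sum_r delta_mx r (diag r).

Definition fflv_linear (x : {ffun Q -> R^o}) : 'M[R]_(k, n) :=
  \sum_r \sum_j
    x (rev_ord r, j) *: (delta_mx r (shift j) - delta_mx r (diag r)).

Lemma fflv_linear_is_linear : linear fflv_linear.
Proof.
move=> a x y; rewrite /fflv_linear scaler_sumr -big_split; apply: eq_bigr => r _.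
rewrite scaler_sumr -big_split; apply: eq_bigr => j _ /=.
by rewrite !ffunE scalerDl scalerA.
Qed.

HB.instance Definition _ := GRing.isLinear.Build R {ffun Q -> R^o} 'M[R]_(k, n)
  _ fflv_linear fflv_linear_is_linear.

Lemma diag_neq_shift r j : (shift j == diag r) = false.
Proof. by apply/eqP => /(congr1 val) /=; have := ltn_ord r; lia. Qed.

Lemma shift_inj : injective shift.
Proof. by move=> i j /cast_ord_inj /rshift_inj. Qed.

(** The coordinates of [x] reappear as the entries in the last [n - k] columns. *)
Lemma fflv_linear_inj : injective fflv_linear.
Proof.
have entry x r j : fflv_linear x r (shift j) = x (rev_ord r, j).
  rewrite summxE (bigD1 r) //= [X in _ + X]big1 ?addr0 => [|q qr].
    rewrite summxE (bigD1 j) //= [X in _ + X]big1 ?addr0 => [|i ij];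
      rewrite !mxE !eqxx /=.
      by rewrite diag_neq_shift subr0 mulr1.
    by rewrite diag_neq_shift (inj_eq shift_inj) eq_sym (negbTE ij) subr0 mulr0.
  rewrite summxE big1 // => i _; rewrite !mxE eq_sym (negbTE qr) /=.
  by rewrite subr0 mulr0.
move=> x y E; apply/ffunP => -[r j].
by rewrite -(rev_ordK r) -!entry E.
Qed.

Definition tuple_of A r : 'I_n :=
  if [pick j | (rev_ord r, j) \in A] is Some j then shift j else diag r.

Definition antichain_of t : {set Q} :=
  [set p : Q | t (rev_ord p.1) == shift p.2]%SET.

Lemma embedding_indicator A : antichain A ->
  base_matrix + fflv_linear (indicator R A) = \sum_r delta_mx r (tuple_of A r).
Proof.
move=> /antichainP aA; rewrite -big_split; apply: eq_bigr => r _ /=.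
rewrite /tuple_of; case: pickP => [j Aj | noA]; last first.
  by rewrite big1 ?addr0 // => j _; rewrite ffunE noA scale0r.
rewrite (bigD1 j) //= big1 ?addr0 => [|i ij]; rewrite ffunE.
  by rewrite Aj scale1r addrC subrK.
case Ai: (_ \in A); last by rewrite scale0r.
suff E : i = j by rewrite E eqxx in ij.
case/orP: (le_total i j) => ji.
  by apply: (congr1 snd (aA _ _ Ai Aj _)); rewrite leEprod /= lexx.
by symmetry; apply: (congr1 snd (aA _ _ Aj Ai _)); rewrite leEprod /= lexx.
Qed.

Lemma tuple_ofP A r :
  (exists2 j, (rev_ord r, j) \in A & tuple_of A r = shift j) \/
  tuple_of A r = diag r.
Proof.
by rewrite /tuple_of; case: pickP => [j Aj|_]; [left; exists j | right].
Qed.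

(** Two cells of an antichain increase strictly in both coordinates once the rows
    are reversed, so an antichain has at most one cell in each row and column. *)
Lemma antichain_fflv_tuple A : antichain A -> fflv_tuple (tuple_of A).
Proof.
move=> /antichainP aA.
have incr r (q : 'I_k) i j : (r < q)%N ->
    (rev_ord r, i) \in A -> (rev_ord q, j) \in A -> (i < j)%N.
  move=> rq Ai Aj; rewrite ltnNge; apply/negP => ji.
  have /(congr1 fst)/rev_ord_inj E : (rev_ord q, j) = (rev_ord r, i).
    by apply: aA => //; rewrite leEprod !leEord /= ji andbT leq_sub2l // ltnW.
  by rewrite E ltnn in rq.
split.
- move=> r q; have [[i Ai ->]|->] := tuple_ofP A r;
    have [[j Aj ->]|->] := tuple_ofP A q.
  + move=> /shift_inj E; subst j; apply: ord_inj.
    have [rq|qr|//] := ltngtP r q.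
      by have := incr _ _ _ _ rq Ai Aj; rewrite ltnn.
    by have := incr _ _ _ _ qr Aj Ai; rewrite ltnn.
  + by move/eqP; rewrite diag_neq_shift.
  + by move/esym/eqP; rewrite diag_neq_shift.
  + by move=> /(congr1 val) /= E; apply: ord_inj.
- by move=> r; have [[i Ai ->] _|->//] := tuple_ofP A r; apply: leq_addr.
- move=> r q rq; have [[i Ai ->]|->//] := tuple_ofP A r.
  have [[j Aj ->]|->//] := tuple_ofP A q.
  by move=> _ _; rewrite ltn_add2l; apply: incr rq Ai Aj.
Qed.

Lemma antichain_of_antichain t : fflv_tuple t -> antichain (antichain_of t).
Proof.
move=> [_ _ incr]; apply/antichainP => -[r i] [q j]; rewrite !inE /=.
have moved s c : t s = shift c -> t s <> s :> nat.
  by move=> -> /=; have := ltn_ord s; lia.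
move=> /eqP ti /eqP tj; rewrite leEprod /= !leEord => /andP[].
rewrite leq_eqVlt => /orP[/eqP/ord_inj rq _ | rq ij].
  by congr (_, _) => //; apply: shift_inj; rewrite -ti -tj rq.
have lt_rev : (rev_ord q < rev_ord r)%N by have := ltn_ord q; rewrite /=; lia.
have := incr _ _ lt_rev (moved _ _ tj) (moved _ _ ti).
by rewrite ti tj ltn_add2l ltnNge ij.
Qed.

Lemma tuple_of_antichain_of t : fflv_tuple t -> tuple_of (antichain_of t) =1 t.
Proof.
move=> [_ big _] r; rewrite /tuple_of; case: pickP => [j|noj].
  by rewrite inE /= rev_ordK => /eqP.
have [E|/eqP/big kt] := eqVneq (t r : nat) r; first exact/ord_inj/esym.
have ltj : (t r - k < n - k)%N by have := ltn_ord (t r); lia.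
have := noj (Ordinal ltj); rewrite inE /= rev_ordK => /eqP[].
by apply: ord_inj => /=; rewrite subnKC.
Qed.

(** Each side is indexed by the same tuples: a subset [J] gives the antichain of its
    tuple, and an antichain gives the set [J] of entries of its tuple. *)
Lemma embedding_generators N (hN : (n ^ 3 <= N)%N) :
  (fun x => base_matrix + fflv_linear x) @` antichain_indicators R Q =
  range (fun J : ksubset k n =>
    \sum_(r < k) delta_mx r (matching_tuple (FFLV_matching_field R k hN) J r)).
Proof.
apply/seteqP; split=> [_ [_ [A aA <-] <-] | _ [J _ <-]]; last first.
  have ft := matching_fflv_tuple R hN J.
  set t := matching_tuple _ J in ft.
  exists (indicator R (antichain_of t)).
    by exists (antichain_of t) => //; apply: antichain_of_antichain.
  rewrite embedding_indicator; last exact: antichain_of_antichain.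
  by apply: eq_bigr => r _; rewrite tuple_of_antichain_of.
have ft := antichain_fflv_tuple aA; have [t_inj _ _] := ft.
have cardJ : #|[set tuple_of A r | r : 'I_k]%SET| == k.
  by rewrite card_imset // card_ord.
exists (exist (fun B : {set 'I_n} => #|B| == k) _ cardJ) => //.
rewrite embedding_indicator //.
apply: eq_bigr => r _; congr delta_mx.
apply: fflv_tuple_uniq => //; first exact: matching_fflv_tuple.
move=> c; rewrite codom_matching_tuple /=.
by apply/imsetP/codomP => [[q _ ->]|[q ->]]; exists q.
Qed.

End Embedding.

Theorem theorem3p5 (R : realType) (k n N : nat)
    (hk : (1 <= k)%N) (hkn : (k < n)%N) (hN : (n ^ 3 <= N)%N) :
  unimodular_equivalent
    (FFLV_polytope R k n)
    (matching_field_polytope R (FFLV_matching_field R k hN)).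
Proof.
rewrite /matching_field_polytope -(embedding_generators R (ltnW hkn) hN).
rewrite -image_convex_hull -chain_polytope_convex_hull.
exact/unimodular_equivalent_image/fflv_linear_inj.
Qed.
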